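(* Let $X,Y$ be finite posets, for each $x\in X$ let $Y_x\subseteq Y$ be totally ordered, let $\Psi$ be a set of pairs $(x_1,x_2)$ in $X$ with $x_1<x_2$, let $T$ be the set of tableaux $f:X\to Y$ with $f(x)\in Y_x$ for all $x$, $f(x_1)\le f(x_2)$ whenever $x_1\le x_2$, and $f(x_1)<f(x_2)$ whenever $(x_1,x_2)\in\Psi$, and let $E\subseteq X\times Y$ contain $\bigcup_{f\in T}f$. Choose a linear extension $\varepsilon$ of the partial order on $X$. Totally order $T$ as follows: for distinct $f_1,f_2\in T$, let $m$ be the $\varepsilon$-largest element of $X$ at which $f_1$ and $f_2$ differ, and place $f_1$ before $f_2$ if $f_1(m)>f_2(m)$. This order on the facets of $\Delta(X,Y,T,E)$ is a shelling.
   Context: A tableau is a function $f:X\to Y$, identified with its graph in $X\times Y$. With $v_{(x,y)}:=E\setminus\{(x,y)\}$, the tableau complex $\Delta(X,Y,T,E)$ is the simplicial complex on ground set $\{v_{(x,y)}:(x,y)\in E\}$ whose faces are the sets $\{v_{(x,y)}:(x,y)\in E\setminus F\}$ for $F\subseteq E$ containing some $f\in T$; its facets are the $f\in T$ (the facet $f$ has vertex set $\{v_{(x,y)}:(x,y)\in E\setminus f\}$). A shelling of a pure $d$-dimensional simplicial complex is an ordering $F_1,\dots,F_k$ of its facets such that $F_i\cap(F_1\cup\dots\cup F_{i-1})$ is pure of dimension $d-1$ for each $2\le i\le k$. *)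

(* Defs.v *)
From HB Require Import structures.
From mathcomp Require Import all_boot all_order all_algebra.
Set Implicit Arguments.
Unset Strict Implicit.
Unset Printing Implicit Defensive.
Import Order.TTheory GRing.Theory Num.Theory.
Local Open Scope order_scope.

Section SimplicialComplexes.
Variable V : finType.
Implicit Types (D : {set {set V}}) (F G : {set V}) (s : seq {set V}).

(* The void complex set0 is allowed, and is distinct from [set set0]. *)
Definition simplicial_complex D : Prop :=
  forall F G, F \in D -> G \subset F -> G \in D.

Definition is_facet D F : bool := maxset (mem D) F.

(* The empty face has dimension -1, hence the values in int. *)
Definition dim_face F : int := (#|F|%:Z - 1)%R.

(* Vacuously true of the void complex, for every d. *)
Definition pure_of_dim D (d : int) : Prop :=
  forall F, is_facet D F -> dim_face F = d.

(* The facets s_0, ..., s_(k-1) are regarded as the simplices powerset s_i. *)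
Definition shelling D s : Prop :=
  simplicial_complex D /\
  exists d : int,
    [/\ pure_of_dim D d,
        uniq s,
        (forall F, (F \in s) = is_facet D F)
      & forall i : nat, (0 < i < size s)%N ->
          pure_of_dim (powerset (nth set0 s i)
                       :&: \bigcup_(j < i) powerset (nth set0 s j)) (d - 1)%R].

End SimplicialComplexes.

Section TableauComplexes.
Variables X Y : finType.

Definition tableau_graph (f : {ffun X -> Y}) : {set X * Y} :=
  [set p | f p.1 == p.2].

Definition tvertex (E : {set X * Y}) (p : X * Y) : {set X * Y} := E :\ p.

Definition tface (E F : {set X * Y}) : {set {set X * Y}} :=
  [set tvertex E p | p in E :\: F].

Definition tableau_complex (T : {set {ffun X -> Y}}) (E : {set X * Y}) :
    {set {set {set X * Y}}} :=
  [set tface E F | F in powerset E & [exists f in T, tableau_graph f \subset F]].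

Definition tfacet (E : {set X * Y}) (f : {ffun X -> Y}) : {set {set X * Y}} :=
  tface E (tableau_graph f).

End TableauComplexes.

Section SemistandardTableaux.
Variables (dX dY : Order.disp_t) (X : finPOrderType dX) (Y : finPOrderType dY).

Definition ss_tableaux (Yx : X -> {set Y}) (Psi : {set X * X}) :
    {set {ffun X -> Y}} :=
  [set f : {ffun X -> Y} |
    [&& [forall x, f x \in Yx x],
        [forall x1, forall x2, (x1 <= x2) ==> (f x1 <= f x2)]
      & [forall x1, forall x2, ((x1, x2) \in Psi) ==> (f x1 < f x2)]]].

Definition linear_extension (eps : rel X) : Prop :=
  [/\ reflexive eps, antisymmetric eps, transitive eps, total eps
    & forall x1 x2 : X, x1 <= x2 -> eps x1 x2].

(* m is the eps-largest element at which f1 and f2 differ. *)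
Definition precedes (eps : rel X) : rel {ffun X -> Y} := fun f1 f2 =>
  [exists m : X, [&& f1 m != f2 m,
                     [forall x, (f1 x != f2 x) ==> eps x m]
                   & f2 m < f1 m]].

End SemistandardTableaux.

Definition strict_total_order_on (U : finType) (A : {set U}) (r : rel U) : Prop :=
  [/\ {in A, irreflexive r},
      {in A & &, transitive r}
    & {in A &, forall u v, u != v -> r u v || r v u}].

(* Main.v *)
Require Import Defs.
From HB Require Import structures.
From mathcomp Require Import all_boot all_order all_algebra.
Set Implicit Arguments.
Unset Strict Implicit.
Unset Printing Implicit Defensive.
Import Order.TTheory GRing.Theory Num.Theory.
Local Open Scope order_scope.

(** Let [f] come before [g] and let [m] be the [eps]-largest point where they
    differ, so [g m < f m].  Raising [g] at [m] to the value [f m] gives a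
    tableau [h]: below [m] the constraints only get weaker, and above [m] the
    tableau [g] agrees with [f].  Then [h] precedes [g], and since the graph of
    [h] lies in the union of those of [f] and [g] and differs from that of [g]
    in one point, the facet of [h] contains the intersection of the facets of
    [f] and [g] and meets the facet of [g] in codimension one. *)

(** * An exchange criterion for shellings of complexes generated by faces of equal size *)

Section ShellingCriterion.
Variables (V : finType) (D : {set {set V}}) (s : seq {set V}) (n : nat).
Hypothesis s_generates : forall G, (G \in D) = has (fun F : {set V} => G \subset F) s.
Hypothesis s_card : {in s, forall F : {set V}, #|F| = n}.

(** Generators of equal cardinality cannot be properly nested, so each of them is maximal. *)
Lemma is_facet_generated F : is_facet D F = (F \in s).
Proof.
have sD G : G \in s -> G \in D.
  by move=> Gs; rewrite s_generates; apply/hasP; exists G.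
apply/maxsetP/idP => [[/= + Fmax]|Fs].
  rewrite s_generates => /hasP[G Gs FG].
  by rewrite -(Fmax G (sD _ Gs) FG).
split=> [|G]; first exact: sD.
rewrite /= s_generates => /hasP[H Hs GH] FG.
have /eqP FH : F == H.
  by rewrite eqEcard (subset_trans FG GH) !s_card /=.
by apply/eqP; rewrite eqEsubset FG FH GH.
Qed.

(** A maximal face [G] of the intersection lies in some [F_i :&: F_j] with [j < i]. The exchange
    hypothesis puts it inside [F_i :&: F_k], which is again a face of the intersection, so
    maximality makes the two equal, and [F_i :&: F_k] has one element less than [F_i]. *)
Lemma shelling_of_exchange :
  uniq s ->
  (forall i j, (j < i < size s)%N ->
     exists k, [/\ (k < i)%N,
       nth set0 s i :&: nth set0 s j \subset nth set0 s k
     & #|nth set0 s i :\: nth set0 s k| = 1%N]) ->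
  shelling D s.
Proof.
move=> s_uniq exch; split=> [F G|].
  rewrite !s_generates => /hasP[H Hs FH] GF.
  by apply/hasP; exists H => //; apply: subset_trans FH.
exists (n%:Z - 1)%R; split=> // [F|F|i /andP[i_gt0 i_s] G].
- by rewrite is_facet_generated => /s_card; rewrite /dim_face => ->.
- by rewrite is_facet_generated.
move=> /maxsetP[/=]; rewrite inE powersetE => /andP[Gi /bigcupP[j _]].
rewrite powersetE => Gj Gmax.
have [|k [ki sub1 card1]] := exch i j; first by rewrite ltn_ord.
have <- : nth set0 s i :&: nth set0 s k = G.
  apply: Gmax; last first.
    by rewrite subsetI Gi (subset_trans _ sub1) // subsetI Gi.
  rewrite /= inE powersetE subsetIl; apply/bigcupP.
  by exists (Ordinal ki) => //; rewrite powersetE subsetIr.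
have := cardsID (nth set0 s k) (nth set0 s i).
rewrite card1 (s_card (mem_nth set0 i_s)) => <-.
by rewrite /dim_face PoszD addrK.
Qed.

End ShellingCriterion.

(** * Faces of a tableau complex as complements in [E] *)

Section TableauFaces.
Variables X Y : finType.
Implicit Types (E F : {set X * Y}) (T : {set {ffun X -> Y}})
  (f g h : {ffun X -> Y}).

(** The restriction to [E] matters: every point outside [E] yields the same set, [E] itself. *)
Lemma tvertex_inj E : {in E &, injective (tvertex E)}.
Proof.
move=> p q pE qE /setP/(_ p); rewrite !inE eqxx pE !andbT /=.
by move=> /esym/negbFE/eqP.
Qed.

Lemma mem_tface E F p : p \in E -> (tvertex E p \in tface E F) = (p \notin F).
Proof.
move=> pE; apply/imsetP/idP => [[q]|pF]; last by exists p; rewrite // inE pF.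
by rewrite inE => /andP[qF qE] /tvertex_inj ->.
Qed.

Lemma card_tface E F : #|tface E F| = #|E :\: F|.
Proof.
apply: card_in_imset => p q; rewrite !inE => /andP[_ pE] /andP[_ qE].
exact: tvertex_inj.
Qed.

(** Up to renaming points as vertices, [tface E] is complementation in [E], so it exchanges unions
    and intersections. *)
Lemma tfaceI E F F' : tface E F :&: tface E F' = tface E (F :|: F').
Proof.
apply/setP => v; rewrite inE; apply/andP/imsetP => [[/imsetP[p + ->]]|[p]].
  rewrite inE => /andP[pF pE]; rewrite mem_tface // => pF'.
  by exists p; rewrite // !inE negb_or pF pF' pE.
by rewrite !inE negb_or => /andP[/andP[pF pF'] pE] ->; rewrite !mem_tface.
Qed.

Lemma tfaceD E F F' :
  tface E F :\: tface E F' = [set tvertex E p | p in E :&: F' :\: F].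
Proof.
apply/setP => v; rewrite inE; apply/andP/imsetP => [[+ /imsetP[p + ev]]|[p]].
  rewrite ev inE => + /andP[pF pE]; rewrite mem_tface // negbK => pF'.
  by exists p; rewrite // !inE pF pF' pE.
by rewrite !inE => /and3P[pF pE pF'] ->; rewrite !mem_tface // negbK.
Qed.

Lemma tfaceS E F F' : F \subset F' -> tface E F' \subset tface E F.
Proof. by move=> FF'; apply/imsetS/setDS. Qed.

Lemma card_tableau_graph f : #|tableau_graph f| = #|X|.
Proof.
have -> : tableau_graph f = [set (x, f x) | x in X].
  apply/setP => -[x y]; rewrite inE /=; apply/eqP/imsetP => [<-|[z _ [-> ->]]] //.
  by exists x.
by rewrite card_imset // => x y [].
Qed.

Lemma card_tfacet E f :
  tableau_graph f \subset E -> #|tfacet E f| = (#|E| - #|X|)%N.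
Proof.
by move=> fE; rewrite card_tface cardsD (setIidPr fE) card_tableau_graph.
Qed.

(** The vertex of [(x, f x)] is missing from the common facet, which puts this point on the graph of
    [g]. *)
Lemma tfacet_inj E f g :
  tableau_graph f \subset E ->
  tfacet E f = tfacet E g -> f = g.
Proof.
move=> /subsetP fE fg; apply/ffunP => x.
have xE : (x, f x) \in E by apply: fE; rewrite inE.
have := mem_tface (tableau_graph f) xE.
by rewrite -/(tfacet E f) fg mem_tface // !inE eqxx => /negbFE/eqP.
Qed.

(** Brings the complex into the generated form that the shelling criterion expects. *)
Lemma mem_tableau_complex T E G :
  {in T, forall f, tableau_graph f \subset E} ->
  (G \in tableau_complex T E) = [exists f in T, G \subset tfacet E f].
Proof.
move=> TE; apply/imsetP/existsP => [[F + ->]|[f /andP[fT Gf]]].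
  rewrite inE => /andP[_ /existsP[f /andP[fT fF]]].
  by exists f; rewrite fT tfaceS.
have/subsetP fE := TE f fT.
(* The complement of [G], read as a set of points; it contains the graph of [f] because [G] avoids
   the vertices of that graph. *)
exists [set p in E | tvertex E p \notin G]; last first.
  apply/setP => v; apply/idP/imsetP => [vG|[p + ->]].
    have /imsetP[p] := subsetP Gf v vG; rewrite inE => /andP[_ pE] ev.
    by exists p; rewrite // !inE pE -ev vG.
  by rewrite !inE => /andP[+ pE]; rewrite pE /= negbK.
rewrite inE powersetE; apply/andP; split.
  by apply/subsetP => p; rewrite inE => /andP[].
apply/existsP; exists f; rewrite fT; apply/subsetP => p pf.
rewrite inE fE //=; apply/negP => /(subsetP Gf).
by rewrite mem_tface ?fE // pf.
Qed.

Definition update_tableau g m y : {ffun X -> Y} :=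
  [ffun x => if x == m then y else g x].

Lemma update_graph_sub f g m :
  tableau_graph (update_tableau g m (f m)) \subset
    tableau_graph g :|: tableau_graph f.
Proof.
apply/subsetP => -[x y]; rewrite !inE ffunE /=.
by case: (x =P m) => [->|_] ->; rewrite ?orbT.
Qed.

Lemma update_graphD g m y : g m != y ->
  tableau_graph (update_tableau g m y) :\: tableau_graph g = [set (m, y)].
Proof.
move=> gmy; apply/setP => -[x z]; rewrite !inE ffunE xpair_eqE /=.
case: (x =P m) => [->|_] /=; last by rewrite andNb.
by rewrite [z == y]eq_sym; case: (y =P z) => [<-|_]; rewrite ?andbF // gmy.
Qed.

End TableauFaces.

(** * The order on semistandard tableaux, and raising one entry *)

Section SemistandardOrder.
Variables (dX dY : Order.disp_t) (X : finPOrderType dX) (Y : finPOrderType dY).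
Variables (Yx : X -> {set Y}) (Psi : {set X * X}) (eps : rel X).
Hypothesis Yx_total : forall x, {in Yx x &, total (<=%O : rel Y)}.
Hypothesis Psi_lt : forall x1 x2, (x1, x2) \in Psi -> x1 < x2.
Hypothesis eps_lin : linear_extension eps.
Implicit Types f g h : {ffun X -> Y}.

Lemma ss_tableauxP f :
  reflect [/\ forall x, f x \in Yx x,
              forall x1 x2, x1 <= x2 -> f x1 <= f x2
            & forall x1 x2, (x1, x2) \in Psi -> f x1 < f x2]
          (f \in ss_tableaux Yx Psi).
Proof.
rewrite inE; apply: (iffP and3P) => -[fY fX fPsi]; split.
- exact/forallP.
- by move=> x y; apply/implyP; move/forallP/(_ x)/forallP: fX; apply.
- by move=> x y; apply/implyP; move/forallP/(_ x)/forallP: fPsi; apply.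
- exact/forallP.
- by apply/forallP => x; apply/forallP => y; apply/implyP; apply: fX.
- by apply/forallP => x; apply/forallP => y; apply/implyP; apply: fPsi.
Qed.

Lemma precedesP f g :
  reflect (exists2 m, forall x, f x != g x -> eps x m & g m < f m)
          (precedes eps f g).
Proof.
apply: (iffP existsP) => -[m].
  by case/and3P=> _ /forallP mmax gf; exists m => // x; apply/implyP.
move=> mmax gf; exists m; rewrite gf (gt_eqF gf) andbT /=.
by apply/forallP => x; apply/implyP; apply: mmax.
Qed.

Lemma precedes_irr : irreflexive (precedes eps : rel {ffun X -> Y}).
Proof. by move=> f; apply/precedesP => -[m _]; rewrite ltxx. Qed.

(** The [eps]-larger of the two points of last difference serves for the composite: there the other
    pair still agrees, so the strict inequality carries over. If the two points coincide, the
    inequalities compose. *)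
Lemma precedes_trans : transitive (precedes eps : rel {ffun X -> Y}).
Proof.
have [_ eps_anti eps_tr eps_tot _] := eps_lin.
move=> g f h /precedesP[m mmax gf] /precedesP[m' m'max hg]; apply/precedesP.
have diff x : f x != h x -> eps x m \/ eps x m'.
  move=> fh; have [eq_fg|/mmax] := eqVneq (f x) (g x); last by left.
  by right; apply: m'max; rewrite -eq_fg.
have [eq_m|neq_m] := eqVneq m m'.
  exists m; last by rewrite (lt_trans _ gf) // eq_m.
  by move=> x /diff[]; rewrite -?eq_m.
case/orP: (eps_tot m m') => le_m.
  exists m'; first by move=> x /diff[] // /eps_tr; apply.
  suff -> : f m' = g m' by [].
  apply/eqP; apply: contraNT neq_m => /mmax le_m'.
  by apply/eqP/eps_anti; rewrite le_m.
exists m; first by move=> x /diff[] // /eps_tr; apply.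
suff <- : g m = h m by [].
apply/eqP; apply: contraNT neq_m => /m'max le_m'.
by apply/eqP/eps_anti; rewrite le_m' le_m.
Qed.

Lemma precedes_total :
  {in ss_tableaux Yx Psi &, forall f g,
    f != g -> precedes eps f g || precedes eps g f}.
Proof.
have [eps_refl _ eps_tr eps_tot _] := eps_lin.
move=> f g /ss_tableauxP[fY _ _] /ss_tableauxP[gY _ _] neq_fg.
have [x0 x0P] : exists x, f x != g x.
  apply/existsP; apply: contraNT neq_fg => /existsPn eq_fg.
  by apply/eqP/ffunP => x; apply/eqP; move/negbNE: (eq_fg x).
have eps'_tr : transitive (fun x y => eps y x).
  by move=> y x z /[swap]; exact: eps_tr.
(* An extremum for the reversed relation is the [eps]-largest difference. *)
have [m mP mmax] := @extremumP X X (fun x y => eps y x) _ (fun x => f x != g x) id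
  eps_refl eps'_tr (fun x y => eps_tot y x) x0P.
case/orP: (Yx_total (fY m) (gY m)); rewrite le_eqVlt => /orP[|lt_m].
- by rewrite (negPf mP).
- apply/orP; right; apply/precedesP; exists m => // x.
  by rewrite eq_sym; apply: mmax.
- by rewrite eq_sym (negPf mP).
- by apply/orP; left; apply/precedesP; exists m.
Qed.

Lemma update_tableau_ss f g m :
  f \in ss_tableaux Yx Psi -> g \in ss_tableaux Yx Psi ->
  (forall x, f x != g x -> eps x m) -> g m < f m ->
  update_tableau g m (f m) \in ss_tableaux Yx Psi.
Proof.
have [_ eps_anti _ _ eps_le] := eps_lin.
move=> /ss_tableauxP[fY fX fPsi] /ss_tableauxP[gY gX gPsi] mmax gf.
(* A difference at [x] would give [eps x m], while [m < x] gives [eps m x]; antisymmetry would force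
   [x = m]. *)
have above x : m < x -> g x = f x.
  move=> mx; apply/eqP; rewrite eq_sym; apply/negPn/negP => /mmax xm.
  have mx' := eps_le _ _ (ltW mx).
  by have := lt_eqF mx; rewrite (eps_anti m x) ?eqxx // mx' xm.
apply/ss_tableauxP; split=> [x|x y le_xy|x y Pxy]; rewrite !ffunE.
- by case: eqP => [->|_].
(* If only [x] is [m], then [g y = f y] and monotonicity of [f] applies; if only [y] is [m], then
   [g x <= g m < f m]. *)
- case: (x =P m) => [xm|_]; case: (y =P m) => [ym|/eqP ym] //.
  + have mx : m < y by rewrite lt_neqAle eq_sym ym -xm.
    by rewrite above // fX // ltW.
  + by rewrite (le_trans _ (ltW gf)) // gX // -ym.
  + exact: gX.
- case: (x =P m) => [xm|_]; case: (y =P m) => [ym|/eqP ym] //.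
  + by have := Psi_lt Pxy; rewrite xm ym ltxx.
  + by rewrite above ?fPsi // -xm // Psi_lt.
  + by rewrite (lt_trans _ gf) // gPsi // -ym.
  + exact: gPsi.
Qed.

Lemma update_tableau_precedes g m y :
  g m < y -> precedes eps (update_tableau g m y) g.
Proof.
have [eps_refl _ _ _ _] := eps_lin.
move=> gy; apply/precedesP; exists m; last by rewrite ffunE eqxx.
by move=> x; rewrite ffunE; case: (x =P m) => [->|]; rewrite ?eqxx.
Qed.

End SemistandardOrder.

Theorem theorem2p13 (dX dY : Order.disp_t)
    (X : finPOrderType dX) (Y : finPOrderType dY)
    (Yx : X -> {set Y})
    (Yx_total : forall x, {in Yx x &, total (<=%O : rel Y)})
    (Psi : {set X * X})
    (Psi_lt : forall x1 x2, (x1, x2) \in Psi -> x1 < x2)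
    (E : {set X * Y})
    (subE : \bigcup_(f in ss_tableaux Yx Psi) tableau_graph f \subset E)
    (eps : rel X) (eps_lin : linear_extension eps) :
  strict_total_order_on (ss_tableaux Yx Psi) (precedes eps) /\
  forall s : seq {ffun X -> Y},
    uniq s -> s =i ss_tableaux Yx Psi -> pairwise (precedes eps) s ->
    shelling (tableau_complex (ss_tableaux Yx Psi) E) (map (tfacet E) s).
Proof.
set T := ss_tableaux Yx Psi.
have TE : {in T, forall f, tableau_graph f \subset E}.
  by move=> f fT; apply: subset_trans subE; apply: bigcup_sup fT.
split.
  split; [by move=> f _; apply: precedes_irr | | exact: precedes_total].
  by move=> f g h _ _ _; apply: precedes_trans.
move=> s s_uniq sT s_pw.
(* Each graph has [#|X|] points, all in [E], so this is the number of vertices of every facet. *)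
apply: (shelling_of_exchange (n := (#|E| - #|X|)%N)).
- move=> G; rewrite mem_tableau_complex //.
  apply/existsP/hasP => [[f /andP[fT Gf]]|[_ /mapP[f fs ->] Gf]].
    by exists (tfacet E f) => //; rewrite map_f ?sT.
  by exists f; rewrite -sT fs.
- by move=> _ /mapP[f fs ->]; rewrite card_tfacet // TE // -sT.
- rewrite map_inj_in_uniq // => f g; rewrite sT => fT _.
  by apply: tfacet_inj; apply: TE.
move=> i j; rewrite size_map => /andP[ji i_s].
have j_s := ltn_trans ji i_s.
(* A default for [nth], taken from [s] itself since the function type may be empty in general. *)
have [f0 _] : exists f : {ffun X -> Y}, true by case: (s) i_s => // f; exists f.
have prec k l : (k < l < size s)%N -> precedes eps (nth f0 s k) (nth f0 s l).
  case/andP=> kl l_s; move/(pairwiseP f0): s_pw; apply=> //.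
  by rewrite inE (ltn_trans kl).
have nthT k : (k < size s)%N -> nth f0 s k \in T.
  by move=> k_s; rewrite -sT mem_nth.
have /precedesP[m mmax lt_m] : precedes eps (nth f0 s j) (nth f0 s i).
  by rewrite prec // ji.
set f := nth f0 s j in mmax lt_m; set g := nth f0 s i in mmax lt_m.
pose h := update_tableau g m (f m).
have hT : h \in T by apply: (update_tableau_ss Psi_lt eps_lin); rewrite ?nthT.
have hg : precedes eps h g := update_tableau_precedes eps_lin lt_m.
have h_s : (index h s < size s)%N by rewrite index_mem sT.
have nth_h : nth f0 s (index h s) = h by rewrite nth_index // sT.
exists (index h s); split.
(* Were [h] not placed before [g], it would equal [g] or come after it, and with [hg] some tableau
   would precede itself. *)
- rewrite ltnNge leq_eqVlt; apply/negP => /orP[/eqP i_h|i_h].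
    by move: hg; rewrite -nth_h -i_h precedes_irr.
  have := prec i (index h s); rewrite i_h h_s nth_h => /(_ isT) gh.
  by have := precedes_trans eps_lin hg gh; rewrite precedes_irr.
- rewrite !(nth_map f0) // nth_h tfaceI; apply: tfaceS.
  exact: update_graph_sub.
(* The one vertex lost is that of [(m, f m)], the only point of the graph of [h] off the graph of
   [g]. *)
rewrite !(nth_map f0) // nth_h tfaceD (setIidPr (TE h hT)).
by rewrite update_graphD ?imset_set1 ?cards1 // (lt_eqF lt_m).
Qed.
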